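(* Let $n\ge 2$ and let $\Omega\subset\mathbb{R}^n$ be a smooth bounded strictly convex domain, and let $d$ be the radius of the largest ball inscribed in $\Omega$. Let $u$ be the solution of either \[ \mathrm{div}\Big(\frac{\nabla u}{\sqrt{1+|\nabla u|^2}}\Big)=\frac{1}{(1+|\nabla u|^2)^{3/2}}\ \text{in }\Omega,\qquad u=0\ \text{on }\partial\Omega, \] or \[ \mathrm{div}\Big(\frac{\nabla u}{\sqrt{1-|\nabla u|^2}}\Big)=\frac{1}{(1-|\nabla u|^2)^{3/2}},\quad |\nabla u|<1\ \text{in }\Omega,\qquad u=0\ \text{on }\partial\Omega. \] Then, with $u_{\min}=\min_{\overline\Omega}u$, \[ -u_{\min}\le\frac{d^2}{2}. \] *)

(* Defs.v *)
From HB Require Import structures.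
From mathcomp Require Import all_boot all_order all_algebra.
From mathcomp Require Import all_classical all_reals all_analysis.
Set Implicit Arguments. Unset Strict Implicit. Unset Printing Implicit Defensive.
Import Order.TTheory GRing.Theory Num.Theory.
Import numFieldNormedType.Exports.
Local Open Scope classical_set_scope.
Local Open Scope ring_scope.

Section Defs.
Variables (R : realType) (n : nat).
Notation V := 'rV[R]_n.

Definition ei (i : 'I_n) : V := delta_mx 0 i.

(* Euclidean norm (the library's norm on matrices is the max-norm) *)
Definition enorm (x : V) : R := Num.sqrt (\sum_(i < n) x 0 i ^+ 2).

Definition eball (c : V) (r : R) : set V := [set y | enorm (y - c) < r].

Definition partial (f : V -> R) (i : 'I_n) : V -> R :=
  fun x => 'D_(ei i) f x.

Definition partialn (l : seq 'I_n) (f : V -> R) : V -> R :=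
  foldr (fun i g => partial g i) f l.

Definition grad_sq (f : V -> R) (x : V) : R :=
  \sum_(i < n) (partial f i x) ^+ 2.

Definition divergence (F : 'I_n -> V -> R) (x : V) : R :=
  \sum_(i < n) partial (F i) i x.

Definition smooth_fun (f : V -> R) : Prop :=
  forall (l : seq 'I_n) (x : V), differentiable (partialn l f) x.

Definition smooth_bounded_domain (O : set V) : Prop :=
  [/\ open O, connected O, O !=set0,
      (exists M : R, forall x, O x -> enorm x <= M) &
      exists rho : V -> R, [/\ smooth_fun rho,
        O = [set x | rho x < 0] &
        forall x, rho x = 0 -> exists i, partial rho i x != 0]].

Definition strictly_convex (O : set V) : Prop :=
  forall x y, closure O x -> closure O y -> x != y ->
    forall t : R, 0 < t < 1 -> O ((1 - t) *: x + t *: y).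

Definition inradius (O : set V) : R :=
  sup [set r : R | 0 < r /\ exists c, eball c r `<=` O].

Definition C2_C0bar (O : set V) (u : V -> R) : Prop :=
  [/\ {within closure O, continuous u},
      (forall x, O x -> differentiable u x),
      (forall i x, O x -> differentiable (partial u i) x) &
      (forall i j x, O x -> {for x, continuous (partial (partial u i) j)})].

Definition solves_eq1 (O : set V) (u : V -> R) : Prop :=
  forall x, O x ->
    divergence (fun i y => partial u i y / Num.sqrt (1 + grad_sq u y)) x
    = 1 / (Num.sqrt (1 + grad_sq u x)) ^+ 3.

Definition solves_eq2 (O : set V) (u : V -> R) : Prop :=
  (forall x, O x -> grad_sq u x < 1) /\
  forall x, O x ->
    divergence (fun i y => partial u i y / Num.sqrt (1 - grad_sq u y)) x
    = 1 / (Num.sqrt (1 - grad_sq u x)) ^+ 3.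

End Defs.

(* Main.v *)
Require Import Defs.
From HB Require Import structures.
From mathcomp Require Import all_boot all_order all_algebra.
From mathcomp Require Import all_classical all_reals all_analysis.
From mathcomp Require Import ring lra.
Import Order.TTheory GRing.Theory Num.Theory.
Import numFieldNormedType.Exports.
Local Open Scope classical_set_scope.
Local Open Scope ring_scope.
Set Implicit Arguments.
Unset Strict Implicit.
Unset Printing Implicit Defensive.

(** Let dl be the distance to the complement of Omega, d the inradius, K > 1,
    D > d and phi(t) = K ((D - t)^2 - D^2) / 2, which decreases on [0, D].
    Then phi(dl) is a strict viscosity subsolution of both equations: at an
    interior point, if l is the distance to the hyperplane supporting Omega at
    a nearest boundary point, convexity gives dl <= l with equality at the
    point, so phi(l) touches phi(dl) from below, and phi(l) is a function of
    one variable on which both operators reduce to phi'' = K > 1.  Hence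
    u - phi(dl) has no interior minimum; as it vanishes on the boundary,
    u >= phi(dl) >= - K D^2 / 2, and K -> 1, D -> d gives the bound. *)

(** * Euclidean inner product, norm, and distance to a closed set *)

Section EuclideanSpace.
Variables (R : realType) (n : nat).
Implicit Types (x y z v w : 'rV[R]_n) (C : set 'rV[R]_n).

Definition edot x y : R := \sum_(i < n) x 0 i * y 0 i.

Lemma edotC x y : edot x y = edot y x.
Proof. by apply: eq_bigr => i _; rewrite mulrC. Qed.

Lemma edotDl x y z : edot (x + y) z = edot x z + edot y z.
Proof. by rewrite -big_split; apply: eq_bigr => i _; rewrite !mxE mulrDl. Qed.

Lemma edotZl a x z : edot (a *: x) z = a * edot x z.
Proof. by rewrite big_distrr/=; apply: eq_bigr => i _; rewrite !mxE mulrA. Qed.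

Lemma edotNl x z : edot (- x) z = - edot x z.
Proof. by rewrite -scaleN1r edotZl mulN1r. Qed.

Lemma edotBl x y z : edot (x - y) z = edot x z - edot y z.
Proof. by rewrite edotDl edotNl. Qed.

Lemma edotDr x y z : edot z (x + y) = edot z x + edot z y.
Proof. by rewrite edotC edotDl !(edotC z). Qed.

Lemma edotZr a x z : edot z (a *: x) = a * edot z x.
Proof. by rewrite edotC edotZl (edotC z). Qed.

Lemma edotNr x z : edot z (- x) = - edot z x.
Proof. by rewrite edotC edotNl (edotC z). Qed.

Lemma edot0l z : edot 0 z = 0.
Proof. by rewrite -(scale0r 0) edotZl mul0r. Qed.

Lemma edot_ge0 x : 0 <= edot x x.
Proof. by apply: sumr_ge0 => i _; rewrite -expr2 sqr_ge0. Qed.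

Lemma edot_ei x i : edot (ei R i) x = x 0 i.
Proof.
rewrite /edot (bigD1 i)//= big1 ?addr0 => [|j ji].
  by rewrite /ei mxE !eqxx mul1r.
by rewrite /ei mxE (negPf ji) andbF mul0r.
Qed.

Lemma enormE x : enorm x = Num.sqrt (edot x x).
Proof. by congr Num.sqrt; apply: eq_bigr => i _; rewrite expr2. Qed.

Lemma enorm_ge0 x : 0 <= enorm x.
Proof. exact: sqrtr_ge0. Qed.

Lemma sqr_enorm x : enorm x ^+ 2 = edot x x.
Proof. by rewrite enormE sqr_sqrtr ?edot_ge0. Qed.

Lemma enormN x : enorm (- x) = enorm x.
Proof. by rewrite !enormE edotNl edotNr opprK. Qed.

Lemma enormBC x y : enorm (x - y) = enorm (y - x).
Proof. by rewrite -enormN opprB. Qed.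

Lemma enormZ a x : enorm (a *: x) = `|a| * enorm x.
Proof.
by rewrite !enormE edotZl edotZr mulrA -expr2 sqrtrM ?sqr_ge0// sqrtr_sqr.
Qed.

Lemma normr_coord_le_enorm x i : `|x 0 i| <= enorm x.
Proof.
rewrite -sqrtr_sqr enormE ler_sqrt ?edot_ge0//.
rewrite /edot (bigD1 i)//= -expr2 lerDl; apply: sumr_ge0 => j _.
by rewrite -expr2 sqr_ge0.
Qed.

Lemma enorm_gt0 x : (0 < enorm x) = (x != 0).
Proof.
rewrite lt_neqAle enorm_ge0 andbT eq_sym; congr negb.
apply/eqP/eqP => [x0|->]; last by rewrite enormE edot0l sqrtr0.
apply/rowP => i; rewrite mxE; apply/eqP; rewrite -normr_le0 -x0.
exact: normr_coord_le_enorm.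
Qed.

Lemma normr_le_enorm x : `|x| <= enorm x.
Proof.
rewrite [leLHS]/Num.norm /= mx_normrE; apply/bigmax_leP; split=> [|[a i] _ /=].
  exact: enorm_ge0.
by rewrite ord1 normr_coord_le_enorm.
Qed.

Lemma edot_le_enorm x y : edot x y <= enorm x * enorm y.
Proof.
have [->|y0] := eqVneq y 0.
  by rewrite edotC edot0l mulr_ge0 ?enorm_ge0.
rewrite -enorm_gt0 in y0.
(* With [a], [b] the norms of [x], [y] and [c] their product, this square expands to
   [2 a b (a b - c)]. *)
have := edot_ge0 (enorm y *: x - enorm x *: y).
have [->|x0] := eqVneq x 0.
  by rewrite edot0l mulr_ge0 ?enorm_ge0.
rewrite -enorm_gt0 in x0.
rewrite !(edotDl, edotDr, edotNl, edotNr, edotZl, edotZr) (edotC y x).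
rewrite -!sqr_enorm; set a := enorm x; set b := enorm y; set c := edot x y.
move=> h; have {}h : 0 <= 2 * (a * b) * (a * b - c) by move: h; lra.
by move: h; rewrite pmulr_rge0 ?subr_ge0// mulr_gt0// mulr_gt0.
Qed.

Lemma enormD x y : enorm (x + y) <= enorm x + enorm y.
Proof.
rewrite -(@ler_pXn2r _ 2) ?nnegrE ?addr_ge0 ?enorm_ge0//.
rewrite sqr_enorm edotDl !edotDr (edotC y x) sqrrD -!sqr_enorm.
by have := edot_le_enorm x y; lra.
Qed.

Lemma continuous_enorm : continuous (@enorm R n).
Proof.
have sum_cont : continuous (fun y : 'rV[R]_n => \sum_(i < n) y 0 i ^+ 2).
  apply: continuous_big => [|i _ y]; first exact: add_continuous.
  apply: (@continuous_comp _ _ _ (fun y : 'rV[R]_n => y 0 i) (fun r : R => r ^+ 2)).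
    exact: coord_continuous.
  exact: exprn_continuous.
move=> x; apply: (@continuous_comp _ _ _ _ (@Num.sqrt R)); first exact: sum_cont.
exact: sqrt_continuous.
Qed.

Lemma continuous_enormB x : continuous (fun y => enorm (x - y)).
Proof.
move=> y; apply: (@continuous_comp _ _ _ (fun y => x - y) (@enorm R n)).
  by apply: (@continuousB _ _ _ (fun=> x) id y) => //; exact: cst_continuous.
exact: continuous_enorm.
Qed.

(** Passes from Euclidean bounds to [bounded_set], which refers to the max-norm. *)
Lemma enorm_bounded C (M : R) : (forall x, C x -> enorm x <= M) -> bounded_set C.
Proof.
move=> CM; exists M; split; first exact: num_real.
move=> r Mr x Cx; apply: (le_trans (normr_le_enorm x)).
exact: (le_trans (CM _ Cx) (ltW Mr)).
Qed.

Lemma nearest_point C x : closed C -> C !=set0 ->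
  exists2 y, C y & forall z, C z -> enorm (x - y) <= enorm (x - z).
Proof.
move=> clC [w Cw].
have cenx := @continuous_enormB x.
(* Points of [C] farther from [x] than [w] cannot be nearest, so minimising over this compact part
   suffices. *)
pose B := C `&` [set y | enorm (x - y) <= enorm (x - w)].
have Bw : B w by split => //=.
have cB : compact B.
  apply: bounded_closed_compact.
    apply: (@enorm_bounded _ (enorm x + enorm (x - w))) => y [_ /= xy].
    have -> : y = x - (x - y) by rewrite opprB addrCA subrr addr0.
    by rewrite (le_trans (enormD _ _))// enormN lerD2l.
  apply: closedI => //.
  by move/continuous_closedP : cenx => /(_ [set r | r <= enorm (x - w)]);
    apply; exact: closed_le.
have [|y] := compact_EVT_min (ex_intro _ w Bw) cB (f := fun y => enorm (x - y)).
  exact: continuous_subspaceT.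
rewrite inE => -[Cy _] ymin; exists y => // z Cz.
have [zw|/ltW wz] := leP (enorm (x - z)) (enorm (x - w)).
  by apply: ymin; rewrite inE; split.
by apply: le_trans wz; apply: ymin; rewrite inE.
Qed.

(** The minimum is attained, and the triangle inequality makes it 1-Lipschitz, hence continuous. *)
Lemma exists_distance C : closed C -> C !=set0 ->
  exists dl : 'rV[R]_n -> R,
    [/\ forall x, exists2 y, C y & dl x = enorm (x - y),
        forall x z, C z -> dl x <= enorm (x - z) &
        continuous dl].
Proof.
move=> clC C0.
have /choice[p pP] : forall x, exists y, C y /\
    forall z, C z -> enorm (x - y) <= enorm (x - z).
  by move=> x; have [y] := nearest_point x clC C0; exists y.
exists (fun x => enorm (x - p x)).
split=> [x|x z Cz|x].
- by exists (p x) => //; have [] := pP x.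
- by have [_] := pP x; exact.
have lip y z : enorm (y - p y) - enorm (z - p z) <= enorm (y - z).
  rewrite lerBlDr; have [_ /(_ (p z))] := pP y; have [Cpz _] := pP z.
  move=> /(_ Cpz) /le_trans; apply.
  by rewrite (le_trans _ (enormD _ _))// addrA subrK.
apply/(@cvgrPdist_lt _ _ _ (nbhs (x : 'rV[R]_n))) => e e0.
(* The Lipschitz bound reduces continuity of the distance to that of [enorm (x - y)] at [y = x],
   where it vanishes. *)
have /cvgrPdist_lt := @continuous_enormB x x.
move=> /(_ _ e0); apply: filterS => y.
have -> : enorm (x - x) = 0 by rewrite subrr enormE edot0l sqrtr0.
rewrite sub0r normrN ger0_norm ?enorm_ge0//; apply: le_lt_trans.
by have := lip x y; have := lip y x; rewrite (enormBC y x) ler_norml; lra.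
Qed.

End EuclideanSpace.

(** * Derivatives along lines and second-order conditions at a minimum *)

Section Derivatives.
Variable R : realType.

(** If [c] were negative, [k] would be negative just to the right of 0, and the mean value theorem
    would give [h t < h 0] there. The second derivative is required at 0 only. *)
Lemma second_order_minimum (h k : R -> R) (c : R) :
    (\forall t \near (0 : R), is_derive (t : R) (1 : R) h (k t)) ->
    is_derive (0 : R) (1 : R) k c ->
    (\forall t \near (0 : R), h 0 <= h t) ->
  k 0 = 0 /\ 0 <= c.
Proof.
move=> dh dk hmin.
have [e /= e0 he] : nbhs_ball (0 : R)
    [set t : R | is_derive t 1 h (k t) /\ h 0 <= h t].
  by apply/nbhs_ballP; exact: filterI.
have {}he (t : R) : `|t| < e -> is_derive t 1 h (k t) /\ h 0 <= h t.
  by move=> te; apply: he; rewrite /ball/= sub0r normrN.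
have k0 : k 0 = 0.
  have [_ <-] : is_derive (0 : R) 1 h (k 0) by have [] := he 0 ltac:(by rewrite normr0).
  have [|t|||_ ->//] := @derive1_at_min _ h (- e) e 0.
  - by lra.
  - by rewrite in_itv/= -ltr_norml => /he[].
  - by rewrite in_itv/=; lra.
  - by move=> t; rewrite in_itv/= -ltr_norml => /he[].
split=> //; rewrite leNgt; apply/negP => c0.
have [kd kc] := dk.
have : (fun t => t^-1 *: ((k \o shift 0) (t *: 1) - k 0)) @ 0^' --> c.
  by rewrite -kc.
move=> /(_ [set r | r < 0]) []; first exact: lt_nbhsl.
move=> e' /= e'0 he'.
(* Halving puts [t] strictly inside both neighbourhoods: the one where [h] has derivative [k], and
   the one where the difference quotient of [k] is negative. *)
pose t := Num.min e e' / 2.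
have m0 : 0 < Num.min e e' by rewrite lt_min e0.
have t0 : 0 < t by rewrite divr_gt0.
have te : t < e by rewrite (@lt_le_trans _ _ (Num.min e e')) ?ge_min ?lexx// /t; lra.
have te' : t < e'.
  by rewrite (@lt_le_trans _ _ (Num.min e e')) ?ge_min ?lexx ?orbT// /t; lra.
have hd s : s \in `[0, t]%R -> is_derive s 1 h (k s).
  by rewrite in_itv/= => /andP[s0 st]; have [] := he s; rewrite ?ger0_norm//; lra.
have hd' s : s \in `]0, t[%R -> is_derive s 1 h (k s).
  by move=> /subset_itv_oo_cc; exact: hd.
have hc : {within `[0, t], continuous h}.
  by apply: derivable_within_continuous => s /hd[].
have [s] := MVT t0 hd' hc.
rewrite in_itv/= subr0 => /andP[s0 st] hE.
have : s^-1 * k s < 0.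
  have /= := he' s; rewrite k0 subr0 addr0 [_ *: 1]mulr1; apply.
    by rewrite /ball_/= sub0r normrN gtr0_norm// (lt_trans st).
  by rewrite gt_eqF.
rewrite pmulr_rlt0 ?invr_gt0// => ks.
have [_] := he t ltac:(by rewrite gtr0_norm).
by rewrite -subr_ge0 hE pmulr_lge0// leNgt ks.
Qed.

(** A directional derivative is an ordinary derivative along the line [t *: v + x], where the
    one-variable rules for square root and inverse apply. *)
Lemma is_derive_div_sqrt (V : normedModType R) (f g : V -> R) (x v : V) (a b : R) :
    0 < g x -> is_derive x v f a -> is_derive x v g b ->
  is_derive x v (fun y => f y / Num.sqrt (g y))
    (a / Num.sqrt (g x) - f x * b / (2 * Num.sqrt (g x) ^+ 3)).
Proof.
move=> gx0 [df <-] [dg <-].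
have lineE (h : V -> R) : 'D_v h x = 'D_1 (fun t : R => h (t *: v + x)) 0.
  rewrite /derive; set F := (X in lim (X @ _) = _).
  set G := (X in _ = lim (X @ _)); suff -> : F = G by [].
  by apply/funext => t; rewrite /F /G/= addr0 scale0r add0r [_ *: 1]mulr1.
have [f1 g1] : is_derive (0 : R) 1 (fun t : R => f (t *: v + x)) ('D_v f x) /\
   is_derive (0 : R) 1 (fun t : R => g (t *: v + x)) ('D_v g x).
  split; apply: DeriveDef; rewrite ?lineE//.
    exact: (derivable1P f x v).1.
  exact: (derivable1P g x v).1.
have s0 : 0 < Num.sqrt (g x) by rewrite sqrtr_gt0.
have s1 : is_derive (0 : R) 1 (fun t : R => Num.sqrt (g (t *: v + x)))
    ('D_v g x * (2 * Num.sqrt (g x))^-1).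
  have := @is_derive1_sqrt R (g x) gx0.
  (* The base point is written as the value of the line at 0, so that the chain rule applies. *)
  have {1}-> : g x = g (0 *: v + x) by rewrite scale0r add0r.
  by move=> s; apply: is_derive_eq; rewrite mulrC.
have i1 : is_derive (0 : R) 1 (fun t : R => (Num.sqrt (g (t *: v + x)))^-1)
    (- Num.sqrt (g x) ^- 2 *: ('D_v g x * (2 * Num.sqrt (g x))^-1)).
  have := @is_deriveV R _ 0 _ 1 _ s1; rewrite scale0r add0r; apply.
  by rewrite gt_eqF.
have [d1 d2] := is_deriveM f1 i1.
apply: DeriveDef; first exact: (derivable1P _ x v).2.
rewrite lineE; apply: (etrans d2).
rewrite scale0r add0r /GRing.scale/=.
by field; rewrite gt_eqF.
Qed.

Variable n : nat.
Implicit Types (f : 'rV[R]_n -> R) (x v : 'rV[R]_n).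

Lemma derive_partial f x v : differentiable f x ->
  'D_v f x = \sum_(i < n) v 0 i * partial f i x.
Proof.
move=> df; rewrite deriveE// {1}(row_sum_delta v) linear_sum.
by apply: eq_bigr => i _; rewrite linearZ/= /partial deriveE.
Qed.

Lemma is_derive_line f x v (t : R) : differentiable f (t *: v + x) ->
  is_derive t 1 (fun s : R => f (s *: v + x))
    (\sum_(i < n) v 0 i * partial f i (t *: v + x)).
Proof.
move=> df; rewrite -derive_partial//.
have E : (fun h : R => h^-1 *: (((fun s => f (s *: v + x)) \o shift t) (h *: 1)
    - f (t *: v + x))) =
    (fun h : R => h^-1 *: ((f \o shift (t *: v + x)) (h *: v) - f (t *: v + x))).
  by apply/funext => h /=; rewrite [_ *: 1]mulr1 scalerDl addrA.
have := @diff_derivable _ _ _ f _ v df; rewrite /derivable -E => d.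
by constructor => //; rewrite /derive E.
Qed.

(** The quadratic [q] touches [f] from below along the line, up to a constant, so
    [second_order_minimum] applies to their difference. *)
Lemma line_minimum f x v (q0 q1 q2 : R)
    (q := fun t => q0 + q1 * t + q2 / 2 * t ^+ 2) :
    (\forall y \near x, differentiable f y) ->
    (forall i, differentiable (partial f i) x) ->
    (\forall t \near (0 : R), f x - q 0 <= f (t *: v + x) - q t) ->
  \sum_(i < n) v 0 i * partial f i x = q1 /\
  q2 <= \sum_(i < n) \sum_(j < n) v 0 i * v 0 j * partial (partial f i) j x.
Proof.
move=> df ddf hmin.
have dq (t : R) : is_derive t 1 q (q1 + q2 * t).
  rewrite /q; apply: is_derive_eq.
  by rewrite /GRing.scale/=; field.
have lx : (fun t : R => t *: v + x) @ 0 --> x.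
  rewrite -[X in _ --> X]add0r -(scale0r v); apply: cvgD; last exact: cvg_cst.
  by apply: cvgZr_tmp; exact: cvg_id.
pose k t := (\sum_(i < n) v 0 i * partial f i (t *: v + x)) - (q1 + q2 * t).
have [| | |k0] := @second_order_minimum (fun t => f (t *: v + x) - q t) k
  (\sum_(i < n) v 0 i * (\sum_(j < n) v 0 j * partial (partial f i) j x) - q2).
- have dft : \forall t \near (0 : R), differentiable f (t *: v + x).
    by apply: (lx [set y | differentiable f y]); exact: df.
  apply: filterS dft => t /= dt.
  exact: (is_deriveB (is_derive_line dt) (dq t)).
- rewrite /k; apply: (@is_deriveB _ _ _ _ (fun t => q1 + q2 * t)).
    have -> : (fun t : R => \sum_(i < n) v 0 i * partial f i (t *: v + x)) =
        \sum_(i < n) (fun t : R => v 0 i * partial f i (t *: v + x)).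
      by apply/funext => t; rewrite fct_sumE.
    apply: is_derive_sum => i.
    apply: (@is_deriveZ _ _ _ (fun t : R => partial f i (t *: v + x))).
    have := @is_derive_line (partial f i) x v 0; rewrite scale0r add0r.
    by apply; exact: ddf.
  by apply: is_derive_eq; rewrite /GRing.scale/=; ring.
- by rewrite scale0r add0r; exact: hmin.
rewrite subr_ge0 => q2le; split.
  by move/eqP: k0; rewrite /k scale0r add0r mulr0 addr0 subr_eq0 => /eqP.
apply: (le_trans q2le); apply: ler_sum => i _.
by rewrite big_distrr/=; apply: ler_sum => j _; rewrite mulrA.
Qed.

End Derivatives.

(** * The equations in expanded form, and the contradiction at a touching point *)

Section Equations.
Variables (R : realType) (n : nat).
Implicit Types (u : 'rV[R]_n -> R) (x : 'rV[R]_n).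

(** One computation serves both equations: [sg] is 1 for the first and -1 for the second. *)
Lemma divergence_quasilinear (sg : R) u x :
    0 < 1 + sg * grad_sq u x ->
    (forall i, differentiable (partial u i) x) ->
  let w := Num.sqrt (1 + sg * grad_sq u x) in
  divergence (fun i y => partial u i y / Num.sqrt (1 + sg * grad_sq u y)) x
  = (w ^+ 2 * (\sum_(i < n) partial (partial u i) i x)
     - sg * \sum_(i < n) \sum_(j < n)
         partial u i x * partial u j x * partial (partial u i) j x) / w ^+ 3.
Proof.
move=> g0 du w; have w0 : 0 < w by rewrite sqrtr_gt0.
have dg j : is_derive x (ei R j) (fun y => 1 + sg * grad_sq u y)
    (sg * (2 * \sum_(i < n) partial u i x * partial (partial u i) j x)).
  have dp i : is_derive x (ei R j) (partial u i) (partial (partial u i) j x).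
    exact/derivableP/diff_derivable.
  have dgs : is_derive x (ei R j) (grad_sq u)
      (2 * \sum_(i < n) partial u i x * partial (partial u i) j x).
    have -> : grad_sq u = \sum_(i < n) (partial u i) ^+ 2.
      by apply/funext => y; rewrite fct_sumE; apply: eq_bigr.
    apply: is_derive_eq; rewrite mulr_sumr; apply: eq_bigr => i _.
    by rewrite /GRing.scale/= mulrA.
  have := is_deriveD (is_derive_cst (1 : R) x (ei R j)) (is_deriveZ sg dgs).
  by rewrite add0r.
have -> : divergence (fun i y => partial u i y / Num.sqrt (1 + sg * grad_sq u y)) x =
    \sum_(j < n) (partial (partial u j) j x / w - partial u j x *
      (sg * (2 * \sum_(i < n) partial u i x * partial (partial u i) j x)) /
      (2 * w ^+ 3)).
  apply: eq_bigr => j _; apply: derive_val.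
  by apply: is_derive_div_sqrt => //; exact/derivableP/diff_derivable.
(* With the index [j] of differentiation outermost on both sides, the identity holds term by
   term. *)
rewrite exchange_big/= mulr_sumr mulr_sumr -sumrB mulr_suml.
apply: eq_bigr => j _.
have -> : \sum_(i < n) partial u i x * partial u j x * partial (partial u i) j x =
    partial u j x * \sum_(i < n) partial u i x * partial (partial u i) j x.
  by rewrite mulr_sumr; apply: eq_bigr => i _; ring.
by field; rewrite gt_eqF.
Qed.

(** The case [i = j] is included, since the formula is later summed over all pairs. *)
Lemma quadratic_form_pair (H : 'I_n -> 'I_n -> R) (i j : 'I_n) (a b : R)
    (v := a *: ei R i + b *: ei R j) :
  \sum_(k < n) \sum_(l < n) v 0 k * v 0 l * H k l =
  a ^+ 2 * H i i + a * b * (H i j + H j i) + b ^+ 2 * H j j.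
Proof.
have pick (F : 'I_n -> R) : \sum_(k < n) v 0 k * F k = a * F i + b * F j.
  have E (m : 'I_n) (G : 'I_n -> R) : \sum_(k < n) ei R m 0 k * G k = G m.
    have := edot_ei (\row_k G k) m; rewrite mxE => <-.
    by apply: eq_bigr => k _; rewrite mxE.
  rewrite -(E i F) -(E j F) !mulr_sumr -big_split/=; apply: eq_bigr => k _.
  by rewrite /v !mxE; ring.
under eq_bigr do under eq_bigr do rewrite -mulrA.
under eq_bigr do rewrite -mulr_sumr pick.
by rewrite pick; ring.
Qed.

(* For a unit vector e, tr H - <He, e> is half the sum of the values of the
   quadratic form at the vectors e_j E_i - e_i E_j, all orthogonal to e. *)
Lemma trace_sub_quadratic_form (H : 'I_n -> 'I_n -> R) (e : 'rV[R]_n) :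
  edot e e = 1 ->
  (\sum_(i < n) H i i) - \sum_(i < n) \sum_(j < n) e 0 i * e 0 j * H i j =
  2^-1 * \sum_(i < n) \sum_(j < n) \sum_(k < n) \sum_(l < n)
    (e 0 j *: ei R i + (- e 0 i) *: ei R j) 0 k *
    (e 0 j *: ei R i + (- e 0 i) *: ei R j) 0 l * H k l.
Proof.
move=> e1.
under [in RHS]eq_bigr do under eq_bigr do rewrite quadratic_form_pair.
have sum2 (F G : 'I_n -> 'I_n -> R) :
    \sum_(i < n) \sum_(j < n) (F i j + G i j) =
    \sum_(i < n) \sum_(j < n) F i j + \sum_(i < n) \sum_(j < n) G i j.
  by rewrite -big_split/=; apply: eq_bigr => i _; rewrite big_split.
have A : \sum_(i < n) \sum_(j < n) e 0 j ^+ 2 * H i i = \sum_(i < n) H i i.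
  apply: eq_bigr => i _; rewrite -mulr_suml -[RHS]mul1r
    -[X in _ = X * _]e1 /edot; congr (_ * _).
rewrite !sum2 A.
have -> : \sum_(i < n) \sum_(j < n) (- e 0 i) ^+ 2 * H j j = \sum_(i < n) H i i.
  rewrite exchange_big/= -A; apply: eq_bigr => i _; apply: eq_bigr => j _.
  by rewrite sqrrN.
(* Both halves of the cross term have the same sum after exchanging [i] and [j], whence the factor
   -2. *)
have -> : \sum_(i < n) \sum_(j < n) e 0 j * - e 0 i * (H i j + H j i) =
    - 2 * \sum_(i < n) \sum_(j < n) e 0 i * e 0 j * H i j.
  transitivity (\sum_(i < n) \sum_(j < n) (- (e 0 i * e 0 j * H i j) +
      - (e 0 j * e 0 i * H j i))).
    by apply: eq_bigr => i _; apply: eq_bigr => j _; ring.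
  rewrite sum2 [X in _ + X]exchange_big/= mulr_sumr -big_split/=.
  apply: eq_bigr => i _; rewrite mulr_sumr -big_split/=.
  by apply: eq_bigr => j _; ring.
by field.
Qed.

(* At a gradient s e, both operators become
   (1 + sg s^2) (tr H - <He, e>) + <He, e>, which is at least K. *)
Lemma barrier_not_touching (sg K s : R) u x (e : 'rV[R]_n) :
    edot e e = 1 -> 1 < K -> 0 < 1 + sg * grad_sq u x ->
    (1 + sg * grad_sq u x) * (\sum_(i < n) partial (partial u i) i x)
     - sg * (\sum_(i < n) \sum_(j < n)
         partial u i x * partial u j x * partial (partial u i) j x) = 1 ->
    (forall i, partial u i x = s * e 0 i) ->
    (forall v, K * edot v e ^+ 2 <= \sum_(i < n) \sum_(j < n)
       v 0 i * v 0 j * partial (partial u i) j x) ->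
  False.
Proof.
move=> e1 K1 g0 eqn gradE hess.
have gE : grad_sq u x = s ^+ 2.
  rewrite -[RHS]mulr1 -[X in _ = _ * X]e1 /edot mulr_sumr; apply: eq_bigr => i _.
  by rewrite gradE; ring.
set Q := \sum_(i < n) \sum_(j < n) e 0 i * e 0 j * partial (partial u i) j x.
have KQ : K <= Q by have := hess e; rewrite e1 expr1n mulr1.
have QE : \sum_(i < n) \sum_(j < n)
    partial u i x * partial u j x * partial (partial u i) j x = s ^+ 2 * Q.
  rewrite mulr_sumr; apply: eq_bigr => i _; rewrite mulr_sumr.
  by apply: eq_bigr => j _; rewrite !gradE; ring.
have := trace_sub_quadratic_form (fun i j => partial (partial u i) j x) e1.
rewrite /= -/Q; set L := \sum_(i < n) partial (partial u i) i x.
set P := \sum_(i < n) _ => LQ.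
have P0 : 0 <= P.
  rewrite /P; apply: sumr_ge0 => i _; apply: sumr_ge0 => j _.
  apply: le_trans (hess _).
  by rewrite mulr_ge0 ?sqr_ge0// (le_trans _ (ltW K1)).
have LE : L = Q + 2^-1 * P by rewrite -LQ addrCA subrr addr0.
(* The equation has become [Q + (1 + sg s^2) P / 2 = 1], while [Q >= K > 1] and [P >= 0]. *)
move: eqn; rewrite QE -/L LE gE; rewrite gE in g0.
have := mulr_ge0 (ltW g0) P0; lra.
Qed.

End Equations.

(** * Supporting hyperplanes, inradius and the barrier comparison *)

Section ConvexDomain.
Variables (R : realType) (n : nat) (O : set 'rV[R]_n).
Implicit Types x y z : 'rV[R]_n.

Lemma strictly_convex_convex x y (t : R) : strictly_convex O ->
  O x -> O y -> 0 < t < 1 -> O ((1 - t) *: x + t *: y).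
Proof.
move=> scO Ox Oy t01; have [<-|xy] := eqVneq x y.
  by rewrite -scalerDl subrK scale1r.
by apply: scO => //; exact: subset_closure.
Qed.

(** If [z] lay strictly beyond the hyperplane through [y] normal to [x - y], then [y] would be on a
    segment from [z] to a point of the ball, hence in [O] by convexity. *)
Lemma inner_ball_support x y z : strictly_convex O ->
    eball x (enorm (x - y)) `<=` O -> ~ O y -> O z ->
  0 <= edot (z - y) (x - y).
Proof.
move=> scO xO nOy Oz; rewrite leNgt; apply/negP => c0; apply: nOy.
set c := edot _ _ in c0; pose N := edot (z - y) (z - y).
have N0 : 0 <= N := edot_ge0 _.
(* Past y, the line from z enters the ball around x. *)
pose t := - c / (N + 1); pose w := y + t *: (y - z).
have t0 : 0 < t by rewrite divr_gt0 ?oppr_gt0// ltr_wpDl.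
have tN : t * (N + 1) = - c by rewrite divfK// gt_eqF// ltr_wpDl.
have Ow : O w.
  apply: xO; rewrite /eball/= -(@ltr_pXn2r _ 2) ?nnegrE ?enorm_ge0//.
  rewrite !sqr_enorm.
  have -> : w - x = - (x - y) - t *: (z - y).
    by rewrite /w -scalerN !opprB addrAC.
  rewrite !(edotDl (- _), edotDr (- _), edotNl, edotNr, edotZl, edotZr).
  rewrite -/N (edotC (x - y) (z - y)) -/c.
  (* By the choice of [t], the excess [2 t c + t^2 N] over the squared radius equals [t c - t^2],
     which is negative. *)
  have := mulr_gt0 t0 t0; nra.
have -> : y = (1 - t / (1 + t)) *: w + (t / (1 + t)) *: z.
  apply/rowP => i; rewrite !mxE; field.
  by rewrite gt_eqF// addr_gt0.
apply: strictly_convex_convex => //.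
by rewrite divr_gt0 ?addr_gt0//= ltr_pdivrMr ?addr_gt0// mul1r ltrDr.
Qed.

(** Moving from [z] along [- e] by slightly more than its height over the supporting hyperplane
    leaves [O], so the distance is at most that length. *)
Lemma distance_le_support (dl : 'rV[R]_n -> R) x y z
    (e := (enorm (x - y))^-1 *: (x - y)) :
    (forall x z, ~ O z -> dl x <= enorm (x - z)) -> strictly_convex O ->
    eball x (enorm (x - y)) `<=` O -> x != y -> ~ O y -> O z ->
  dl z <= edot (z - y) e.
Proof.
move=> dlO scO xO xy nOy Oz.
have r0 : 0 < enorm (x - y) by rewrite enorm_gt0 subr_eq0.
have e1 : edot e e = 1.
  by rewrite edotZl edotZr -sqr_enorm; field; rewrite gt_eqF.
have supp w : O w -> 0 <= edot (w - y) e.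
  move=> Ow; rewrite edotZr mulr_ge0 ?invr_ge0 ?enorm_ge0//.
  exact: inner_ball_support.
(* The margin [tau] is needed because [supp] excludes only negative heights. *)
apply/ler_addgt0Pr => tau tau0; set l := edot (z - y) e.
have nOw : ~ O (z - (l + tau) *: e).
  move=> /supp; rewrite addrAC edotBl -/l edotZl e1; lra.
apply: (le_trans (dlO z _ nOw)); rewrite opprB addrC subrK enormZ enormE e1.
by rewrite sqrtr1 mulr1 ger0_norm// addr_ge0 ?(ltW tau0)//; exact: supp.
Qed.

(** A [sup] dominates its set only if the set is bounded above. Here [M] bounds the radii: a larger
    ball has two antipodal points whose first coordinates cannot both be at most [M] in absolute
    value. *)
Lemma le_inradius (c : 'rV[R]_n) (r M : R) : (0 < n)%N ->
    (forall x, O x -> enorm x <= M) -> 0 < r -> eball c r `<=` O ->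
  r <= inradius O.
Proof.
case: n c O => // m c O' _ OM r0 cO; apply: sup_upper_bound; last first.
  by split => //; exists c.
split; first by exists r; split => //; exists c.
exists M => r' [r'0 [c' c'O]]; rewrite leNgt; apply/negP => Mr'.
(* Taking the maximum with 0 makes the midpoint [t] of [s] and [r'] non-negative as well as larger
   than [M]. *)
pose s := Num.max M 0.
have [s0 Ms] : 0 <= s /\ M <= s by rewrite /s !le_max !lexx orbT.
have sr' : s < r' by rewrite /s gt_max Mr' r'0.
pose t := (s + r') / 2.
have en1 : enorm (ei R ord0 : 'rV[R]_m.+1) = 1.
  by rewrite enormE edot_ei /ei mxE !eqxx sqrtr1.
have inO (a : R) : `|a| = t -> O' (c' + a *: ei R ord0).
  move=> at_; apply: c'O; rewrite /eball/= addrAC subrr add0r enormZ en1 mulr1 at_.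
  by rewrite /t; lra.
have t0 : 0 <= t by rewrite /t; lra.
have /OM h1 := inO t (ger0_norm t0).
have /OM h2 := inO (- t) ltac:(by rewrite normrN ger0_norm).
have := le_trans (normr_coord_le_enorm _ ord0) h1.
have := le_trans (normr_coord_le_enorm _ ord0) h2.
rewrite !mxE !eqxx !mulr1 !ler_norml /t; lra.
Qed.

Lemma bounded_complement_nonempty (M : R) : (0 < n)%N ->
  (forall x, O x -> enorm x <= M) -> (~` O) !=set0.
Proof.
case: n O => // m O' _ OM; exists ((`|M| + 1) *: ei R ord0) => /OM.
apply/negP; rewrite -ltNge enormZ enormE edot_ei /ei mxE !eqxx sqrtr1 mulr1.
by have := ler_norm M; rewrite [X in _ < X]ger0_norm; [lra|have := normr_ge0 M; lra].
Qed.

(** The minimum of [u - phi \o dl] over the compact closure is attained. On the boundary it gives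
    the bound; inside it contradicts [barrier_not_touching]. *)
Lemma barrier_le (u : 'rV[R]_n -> R) (sg K D : R) :
    (0 < n)%N -> open O -> O !=set0 ->
    (exists M : R, forall x, O x -> enorm x <= M) ->
    strictly_convex O -> C2_C0bar O u ->
    (forall x, (closure O `\` O) x -> u x = 0) ->
    (forall x, O x -> 0 < 1 + sg * grad_sq u x) ->
    (forall x, O x ->
      divergence (fun i y => partial u i y / Num.sqrt (1 + sg * grad_sq u y)) x
      = 1 / Num.sqrt (1 + sg * grad_sq u x) ^+ 3) ->
    1 < K -> inradius O < D ->
  forall x, closure O x -> - u x <= K / 2 * D ^+ 2.
Proof.
move=> n0 oO O0 [M OM] scO [cu du ddu _] u0 g0 eqn K1 rD.
have [dl [dlE dlO cdl]] :=
  exists_distance (open_closedC oO) (bounded_complement_nonempty n0 OM).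
pose phi t : R := K / 2 * ((D - t) ^+ 2 - D ^+ 2).
have [dl0 dlr] : (forall x, 0 <= dl x) /\
    (forall x, O x -> 0 < dl x <= inradius O).
  split=> [x|x Ox]; have [y nOy dlx] := dlE x; first by rewrite dlx enorm_ge0.
  have dx0 : 0 < dl x.
    by rewrite dlx enorm_gt0 subr_eq0; apply/eqP => xy; apply: nOy; rewrite -xy.
  rewrite dx0/=; apply: (le_inradius n0 OM dx0 (c := x)) => z.
  rewrite /eball/= (enormBC z) => zx; apply: contrapT => nOz.
  by have := dlO x z nOz; rewrite leNgt zx.
have cJ : {within closure O, continuous (u - (phi \o dl))}.
  have cphi : continuous (phi \o dl).
    move=> x; apply: (@continuous_comp _ _ _ dl phi); first exact: cdl.
    have dphi : derivable phi (dl x) 1 by apply: ex_derive.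
    by apply: differentiable_continuous; exact/derivable1_diffP.
  have {}cphi : {within closure O, continuous (phi \o dl)}.
    exact: continuous_subspaceT.
  exact: within_continuousB.
have cO : compact (closure O).
  apply: bounded_closed_compact; last exact: closed_closure.
  apply: (@enorm_bounded _ _ _ M) => x.
  have clM : closed [set x : 'rV[R]_n | enorm x <= M].
    have /continuous_closedP/(_ [set r | r <= M]) := @continuous_enorm R n.
    by apply; exact: closed_le.
  by move/closure_id: clM => clM /(closureS OM); rewrite -clM.
have clO0 : closure O !=set0.
  by case: O0 => x Ox; exists x; exact: subset_closure.
have [x0] := compact_EVT_min clO0 cO cJ; rewrite inE => clx0.
rewrite -[(u - _) x0]/(u x0 - phi (dl x0)) => x0min.
have [Ox0|nOx0] := pselect (O x0); last first.
  have dlx0 : dl x0 = 0.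
    apply/eqP; rewrite eq_le dl0 andbT (le_trans (dlO x0 _ nOx0))//.
    by rewrite subrr enormE edot0l sqrtr0.
  (* The minimum value is [0 - phi 0 = 0], and [phi] is at least [- K / 2 * D ^+ 2] everywhere. *)
  move=> x clx; have := x0min x; rewrite inE => /(_ clx).
  rewrite -[(u - _) x]/(u x - phi (dl x)).
  rewrite (u0 x0)// dlx0 /phi => h; have := sqr_ge0 (D - dl x).
  by have := K1; nra.
exfalso; have [y0 nOy0 dlx0] := dlE x0.
have /andP[d0 dD] := dlr _ Ox0.
have x0y0 : x0 != y0 by rewrite -subr_eq0 -enorm_gt0 -dlx0.
have ball0 : eball x0 (enorm (x0 - y0)) `<=` O.
  move=> z; rewrite /eball/= (enormBC z) -dlx0 => zx; apply: contrapT => nOz.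
  by have := dlO x0 z nOz; rewrite leNgt zx.
pose e := (enorm (x0 - y0))^-1 *: (x0 - y0).
have e1 : edot e e = 1.
  by rewrite edotZl edotZr -sqr_enorm -dlx0; field; rewrite gt_eqF.
have l0 : edot (x0 - y0) e = dl x0.
  by rewrite edotZr -sqr_enorm -dlx0; field; rewrite gt_eqF.
have nO : \forall y \near x0, O y by exact: open_nbhs_nbhs.
have touch (v : 'rV[R]_n) :
    \sum_(i < n) v 0 i * partial u i x0 = - (K * (D - dl x0)) * edot v e /\
    K * edot v e ^+ 2 <= \sum_(i < n) \sum_(j < n)
       v 0 i * v 0 j * partial (partial u i) j x0.
  (* As [phi] is quadratic, [phi (dl x0 + t * edot v e)] is exactly the [q] of [line_minimum], with
     [q1] and [q2] read off the goal. *)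
  apply: (@line_minimum _ _ _ _ _ (phi (dl x0))).
  - by apply: filterS nO => y; exact: du.
  - by move=> i; exact: ddu.
  have lx : (fun t : R => t *: v + x0) @ 0 --> x0.
    rewrite -[X in _ --> X]add0r -(scale0r v); apply: cvgD; last exact: cvg_cst.
    by apply: cvgZr_tmp; exact: cvg_id.
  have ld : (fun t : R => dl x0 + t * edot v e) @ 0 --> dl x0.
    rewrite -[X in _ --> X]addr0 -[X in _ --> _ + X](mul0r (edot v e)).
    apply: cvgD; first exact: cvg_cst.
    by apply: cvgMr_tmp; exact: cvg_id.
  have nt : \forall t \near (0 : R), O (t *: v + x0) by apply: (lx O).
  (* Below [D] the function [phi] decreases, so the bound of [dl] by the support height becomes a
     lower bound for [phi \o dl]. *)
  have nD : \forall t \near (0 : R), dl x0 + t * edot v e < D.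
    apply: (ld [set r | r < D]); apply: lt_nbhsl.
    exact: le_lt_trans rD.
  apply: filterS2 nt nD => t Ot tD.
  have := x0min (t *: v + x0); rewrite inE => /(_ (subset_closure Ot)).
  rewrite -[(u - _) _]/(u (t *: v + x0) - phi (dl (t *: v + x0))).
  have := distance_le_support dlO scO ball0 x0y0 nOy0 Ot; rewrite -/e.
  rewrite -addrA edotDl edotZl l0; set d := dl (t *: v + x0).
  rewrite /phi; set a := edot v e in tD *; set d1 := dl x0 in tD *.
  move=> dle; have : 0 <= K * ((D - d) ^+ 2 - (D - (t * a + d1)) ^+ 2).
    rewrite mulr_ge0 ?(le_trans _ (ltW K1))// subr_sqr mulr_ge0//; lra.
  lra.
apply: (@barrier_not_touching _ _ sg K (- (K * (D - dl x0))) u x0 e e1 K1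
  (g0 _ Ox0)).
- have w0 : 0 < Num.sqrt (1 + sg * grad_sq u x0) by rewrite sqrtr_gt0 g0.
  have := eqn _ Ox0; rewrite divergence_quasilinear//=; last 2 first.
  + exact: g0.
  + by move=> i; exact: ddu.
  rewrite sqr_sqrtr ?ltW ?g0//.
  (* Multiplying by the cube of the square root clears both denominators. *)
  move=> /(congr1 ( *%R^~ (Num.sqrt (1 + sg * grad_sq u x0) ^+ 3))).
  by rewrite !divfK// gt_eqF// exprn_gt0.
- move=> i; have [+ _] := touch (ei R i); rewrite edot_ei => <-.
  by have := edot_ei (\row_k partial u k x0) i; rewrite mxE => <-;
    apply: eq_bigr => k _; rewrite mxE.
- by move=> v; have [] := touch v.
Qed.

End ConvexDomain.

(** * Both equations at once, and the passage to the limit in [K] and [D] *)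

Theorem theorem5p1 (R : realType) (n : nat) (hn : (2 <= n)%N)
    (Omega : set 'rV[R]_n) (u : 'rV[R]_n -> R) :
  smooth_bounded_domain Omega ->
  strictly_convex Omega ->
  C2_C0bar Omega u ->
  (forall x, (closure Omega `\` Omega) x -> u x = 0) ->
  (solves_eq1 Omega u \/ solves_eq2 Omega u) ->
  forall x, closure Omega x -> - u x <= (inradius Omega) ^+ 2 / 2.
Proof.
move=> [oO _ O0 bO _] scO C2u u0 eqns x clx.
have n0 : (0 < n)%N by exact: leq_trans hn.
have bound K D : 1 < K -> inradius Omega < D -> - u x <= K / 2 * D ^+ 2.
  move=> K1 rD; have grad_ge0 y : 0 <= grad_sq u y.
    by apply: sumr_ge0 => i _; exact: sqr_ge0.
  case: eqns => [eq1|[lt1 eq2]].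
  - have one y : 1 + grad_sq u y = 1 + 1 * grad_sq u y by rewrite mul1r.
    apply: (@barrier_le _ _ _ u 1 K D n0 oO O0 bO scO C2u u0) => //.
    + by move=> y _; rewrite mul1r ltr_wpDr.
    + move=> y /eq1; rewrite one => <-; congr divergence.
      by apply/funext => i; apply/funext => z; rewrite one.
  - have one y : 1 - grad_sq u y = 1 + (- 1) * grad_sq u y by rewrite mulN1r.
    apply: (@barrier_le _ _ _ u (- 1) K D n0 oO O0 bO scO C2u u0) => //.
    + by move=> y /lt1; rewrite mulN1r subr_gt0.
    + move=> y /eq2; rewrite one => <-; congr divergence.
      by apply/funext => i; apply/funext => z; rewrite one.
set d := inradius Omega in bound *.
apply/ler_addgt0Pr => eps eps0.
(* For [K = 1 + eta], [D = d + eta] and [eta <= 1], the excess of [K / 2 * D ^+ 2] over [d ^+ 2 / 2]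
   is at most [eta * b / 2]. *)
pose b := d ^+ 2 + 4 * `|d| + 2.
have b0 : 0 < b by rewrite /b; have := sqr_ge0 d; have := normr_ge0 d; lra.
pose eta := Num.min 1 (eps / b).
have eta0 : 0 < eta by rewrite lt_min ltr01 divr_gt0.
have eta1 : eta <= 1 by rewrite ge_min lexx.
have etab : eta * b <= eps by rewrite -ler_pdivlMr// ge_min lexx orbT.
apply: (le_trans (bound (1 + eta) (d + eta) _ _)); [lra..|].
have dle := ler_norm d; have h := normr_ge0 d.
have : eta * ((1 + eta) * (2 * d + eta)) <= eta * (4 * `|d| + 2).
  rewrite ler_pM2l//; apply: (@le_trans _ _ ((1 + eta) * (2 * `|d| + 1))).
    by rewrite ler_pM2l; lra.
  have := mulr_ge0 h (ltW eta0); nra.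
rewrite /b in etab; lra.
Qed.
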